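(* Let $\alpha\in(0,1)$, let $(H_i)_{i\in\mathbb{N}}$ be a sequence of null hypotheses with $p$-values $(P_i)_{i\in\mathbb{N}}$, and let $(\alpha_i)_{i\in\mathbb{N}}$ be individual significance levels produced by an exhaustive ADDIS algorithm at level $\alpha$ (with parameters $(\tau_i)_{i\in\mathbb{N}}$, $(\lambda_i)_{i\in\mathbb{N}}$), as defined in the context. Suppose that the null $p$-values $(P_i)_{i\in I_0}$ are uniformly valid, independent from each other, and independent from the non-null $p$-values $(P_i)_{i\in\mathbb{N}\setminus I_0}$. Then the procedure controls the familywise error rate in the strong sense at level $\alpha$: for every configuration $I_0\subseteq\mathbb{N}$ of true null hypotheses, $$\text{FWER}=\mathbb{P}\big(\exists\, i\in I_0:\ P_i\le \alpha_i\big)\le \alpha .$$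
   Context: Setting. $(\Omega,\mathcal{A})$ is a measurable space, $\mathcal{P}$ a set of probability distributions on it, and $\mathbb{P}\in\mathcal{P}$ the true data-generating distribution. $(H_i)_{i\in\mathbb{N}}$ is a sequence of null hypotheses about $\mathbb{P}$, with $p$-values $P_i:\Omega\to[0,1]$. $I_0\subseteq\mathbb{N}$ is the index set of true null hypotheses (it depends on $\mathbb{P}$). A $p$-value $P_i$ is called null if $i\in I_0$ and non-null otherwise. ''Independent from each other and independent from the non-null $p$-values'' means that $(P_i)_{i\in I_0}$ is a mutually independent family and that this family is independent of the family $(P_i)_{i\notin I_0}$. Null $p$-values are valid if $\mathbb{P}(P_i\le x)\le x$ for all $x\in[0,1]$, $i\in I_0$. They are uniformly valid if $\mathbb{P}(P_i\le xy\mid P_i\le y)\le x$ for all $x,y\in[0,1]$ (whenever the conditioning event has positive probability) and all $i\in I_0$. Hypothesis $H_i$ is rejected iff $P_i\le\alpha_i$. With $V$ the total number of rejected true null hypotheses, $\text{FWER}=\mathbb{P}(V>0)$. Strong control at level $\alpha$ means $\text{FWER}\le\alpha$ under any configuration of true and false hypotheses. Exhaustive ADDIS algorithm at level $\alpha$. Let $\mathcal{G}_{i}=\sigma(P_1,\ldots,P_{i})$, with $\mathcal{G}_0$ trivial. Put $\alpha^{(1)}=\alpha$. For each $i\in\mathbb{N}$, before observing $P_i$, one chooses $\mathcal{G}_{i-1}$-measurable random variables $\tau_i,\lambda_i,\alpha_i$ (i.e. depending only on $P_1,\dots,P_{i-1}$) with $$\tau_i\in(0,1],\qquad \lambda_i\in[\alpha^{(i)}\tau_i,\tau_i),\qquad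 \alpha_i\in[0,\tau_i),\qquad \alpha^{(i)}-\frac{\alpha_i(1-\alpha^{(i)})}{\tau_i-\lambda_i}\ge 0 .$$ Then $H_i$ is rejected iff $P_i\le\alpha_i$, and one sets $$\alpha^{(i+1)}=\begin{cases}\alpha^{(i)} & \text{if } P_i\le\lambda_i \text{ or } P_i>\tau_i,\\[2pt] \alpha^{(i)}-\dfrac{\alpha_i(1-\alpha^{(i)})}{\tau_i-\lambda_i} & \text{if } \lambda_i<P_i\le\tau_i.\end{cases}$$ Any sequence of choices satisfying these constraints is allowed. *)

(* Defs.v *)
From HB Require Import structures.
From mathcomp Require Import all_boot all_order all_algebra finmap.
From mathcomp Require Import all_classical all_reals all_analysis.

Set Implicit Arguments.
Unset Strict Implicit.
Unset Printing Implicit Defensive.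

Import Order.TTheory GRing.Theory Num.Theory.

Local Open Scope classical_set_scope.
Local Open Scope ring_scope.

(* [family_events X I] is a generating family of sigma(X_i, i in I), which is
   [<<s family_events X I >>]. For [I = set0] the latter is trivial. *)
Definition family_events d (T : measurableType d) (R : realType)
    (X : nat -> T -> R) (I : set nat) : set (set T) :=
  \bigcup_(i in I) preimage_set_system setT (X i) measurable.

Definition family_measurable d (T : measurableType d) (R : realType)
    (X : nat -> T -> R) (I : set nat) (Y : T -> R) : Prop :=
  measurable_fun [set: g_sigma_algebraType (family_events X I)]
    (Y : g_sigma_algebraType (family_events X I) -> R).

Definition mutually_independent d (T : measurableType d) (R : realType)
    (Pr : probability T R) (X : nat -> T -> R) (I : set nat) : Prop :=
  forall (J : {fset nat}) (B : nat -> set R),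
    [set` J] `<=` I -> (forall j, j \in J -> measurable (B j)) ->
    Pr (\bigcap_(j in [set` J]) (X j @^-1` B j)) =
      (\prod_(j <- J) Pr (X j @^-1` B j))%E.

Definition independent_families d (T : measurableType d) (R : realType)
    (Pr : probability T R) (X : nat -> T -> R) (I J : set nat) : Prop :=
  forall A B : set T,
    <<s family_events X I >> A -> <<s family_events X J >> B ->
    Pr (A `&` B) = (Pr A * Pr B)%E.

Definition cond_prob d (T : measurableType d) (R : realType)
    (Pr : probability T R) (A B : set T) : R :=
  fine (Pr (A `&` B)) / fine (Pr B).

Definition uniformly_valid d (T : measurableType d) (R : realType)
    (Pr : probability T R) (p : T -> R) : Prop :=
  forall x y : R, 0 <= x <= 1 -> 0 <= y <= 1 ->
    (0 < Pr [set w | (p w <= y)%R])%E ->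
    cond_prob Pr [set w | p w <= x * y] [set w | p w <= y] <= x.

(* A hypothesis is identified with the set of distributions satisfying it. *)
Definition true_nulls d (T : measurableType d) (R : realType)
    (H : nat -> set (probability T R)) (Pr : probability T R) : set nat :=
  [set i | H i Pr].

(* Indices start at 0, so [addis_level alpha tau lambda a p i] is
   alpha^(i+1) of the usual one-based presentation. *)
Fixpoint addis_level d (T : measurableType d) (R : realType) (alpha : R)
    (tau lambda a p : nat -> T -> R) (i : nat) (w : T) : R :=
  if i is j.+1 then
    let l := addis_level alpha tau lambda a p j w in
    if lambda j w < p j w <= tau j w
    then l - a j w * (1 - l) / (tau j w - lambda j w)
    else l
  else alpha.

Record exhaustive_ADDIS d (T : measurableType d) (R : realType) (alpha : R)
    (p tau lambda a : nat -> T -> R) : Prop := ExhaustiveADDIS {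
  addis_tau_predictable : forall i, family_measurable p `I_i (tau i) ;
  addis_lambda_predictable : forall i, family_measurable p `I_i (lambda i) ;
  addis_a_predictable : forall i, family_measurable p `I_i (a i) ;
  addis_tau_bounds : forall i w, 0 < tau i w <= 1 ;
  addis_lambda_bounds : forall i w,
    addis_level alpha tau lambda a p i w * tau i w <= lambda i w < tau i w ;
  addis_a_bounds : forall i w, 0 <= a i w < tau i w ;
  addis_level_ge0 : forall i w,
    let l := addis_level alpha tau lambda a p i w in
    0 <= l - a i w * (1 - l) / (tau i w - lambda i w)
}.

Definition rejected (T : Type) (R : realType) (p a : nat -> T -> R)
    (w : T) : set nat :=
  [set i | p i w <= a i w].

Definition FWER d (T : measurableType d) (R : realType)
    (Pr : probability T R) (I0 : set nat) (p a : nat -> T -> R) : \bar R :=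
  Pr [set w | exists2 i, I0 i & rejected p a w i].

(* Main.v *)
Require Import Defs.
From HB Require Import structures.
From mathcomp Require Import all_boot all_order all_algebra finmap.
From mathcomp Require Import all_classical all_reals all_analysis.
From mathcomp Require Import measurable_realfun ring lra.

Set Implicit Arguments.
Unset Strict Implicit.
Unset Printing Implicit Defensive.

Import Order.TTheory GRing.Theory Num.Theory.

Local Open Scope classical_set_scope.
Local Open Scope ring_scope.

(* Let [Z i] be [1] if a true null among the first [i] hypotheses has been
   rejected and the current level alpha^(i) otherwise. Since alpha^(i) < 1, the
   constraints force [a i <= lambda i], so uniform validity gives
     (tau - lambda) P(p_i <= a) <= a P(lambda < p_i <= tau)
   conditionally on the past, of which a null p-value is independent: the level
   spent when [lambda < p_i <= tau] pays on average for the jump of [Z] from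
   alpha^(i) to [1] on a false rejection. Non-null p-values can only lower [Z].
   Hence the expectation of [Z i] is nonincreasing, starts at [alpha], and
   dominates the probability of a false rejection before time [i]. *)

(** * Independence of a null p-value from the past *)

(** The joint law of the pair and the product of the marginal laws agree on rectangles, hence
    everywhere; Tonelli then integrates [X] out with [Y] frozen. This plays the role of conditioning
    on [Y]. *)
Lemma integral_indep_pair d d1 d2 (T : measurableType d) (T1 : measurableType d1)
    (T2 : measurableType d2) (R : realType) (Pr : probability T R)
    (Y : {mfun T >-> T1}) (X : {mfun T >-> T2}) (f : T1 * T2 -> \bar R) :
  (forall A B, measurable A -> measurable B ->
    Pr (Y @^-1` A `&` X @^-1` B) = (Pr (Y @^-1` A) * Pr (X @^-1` B))%E) ->
  measurable_fun [set: T1 * T2] f -> (forall z, 0 <= f z)%E ->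
  (\int[Pr]_w f (Y w, X w) =
   \int[Pr]_w \int[distribution Pr X]_x f (Y w, x))%E.
Proof.
move=> ind mf f0.
have mYX : measurable_fun setT (fun w => (Y w, X w)).
  by apply: measurable_fun_pair.
pose YX : {mfun T >-> (T1 * T2)%type} := mfun_Sub (mem_set mYX).
have -> : (\int[Pr]_w f (Y w, X w) = \int[distribution Pr YX]_z f z)%E.
  by rewrite ge0_integral_distribution.
have E Z : measurable Z -> (distribution Pr Y \x distribution Pr X)%E Z =
    distribution Pr YX Z.
  by apply: product_measure_unique => A B mA mB; rewrite -ind.
rewrite (eq_measure_integral (distribution Pr Y \x distribution Pr X)%E);
  last by move=> A mA _; apply/esym/E.
rewrite fubini_tonelli1 // ge0_integral_distribution //.
  exact: measurable_fun_fubini_tonelli_F.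
by move=> y; apply: integral_ge0 => x _.
Qed.

(** A cylinder over the past splits into a null and a non-null part. Independence of the families
    detaches the non-null part, mutual independence detaches [p i] from the null part, and
    uniqueness of measures on a pi-system extends the product formula from cylinders to the whole
    past. *)
Lemma null_indep_past d (T : measurableType d) (R : realType)
    (Pr : probability T R) (p : nat -> {mfun T >-> R}) (I : set nat) (i : nat)
    (A : set T) (B : set R) :
  mutually_independent Pr p I -> independent_families Pr p I (~` I) -> I i ->
  <<s family_events p `I_i >> A -> measurable B ->
  Pr (A `&` p i @^-1` B) = (Pr A * Pr (p i @^-1` B))%E.
Proof.
move=> indI indN Ii sA mB.
have mp j (C : set R) : measurable C -> measurable (p j @^-1` C).
  by move=> mC; rewrite -[X in measurable X]setTI; exact: measurable_funP.
pose G : set (set T) := [set A | exists2 C : nat -> set R,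
  forall j, measurable (C j) & A = \bigcap_(j in `I_i) (p j @^-1` C j)].
have fG : family_events p `I_i `<=` G.
  move=> _ [j /= ji] [C mC] <-.
  exists (fun k => if k == j then C else setT) => [k|]; first by case: ifP.
  rewrite setTI; apply/seteqP; split => w /=.
    by move=> Cw k _; case: eqP => // ->.
  by move=> /(_ j ji); rewrite eqxx.
have GI : setI_closed G.
  move=> _ _ [C mC ->] [D mD ->]; exists (fun j => C j `&` D j).
    by move=> j; exact: measurableI.
  apply/seteqP; split => w /=.
    by move=> [Cw Dw] j ji; split; [exact: Cw|exact: Dw].
  by move=> CDw; split => j ji; have [] := CDw j ji.
have mfamily K j (C : set R) : K j -> measurable C ->
    <<s family_events p K >> (p j @^-1` C).
  move=> Kj mC; apply: sub_gen_smallest; exists j => //.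
  by exists C => //; rewrite setTI.
have Gind D : G D -> Pr (D `&` p i @^-1` B) = (Pr D * Pr (p i @^-1` B))%E.
  move=> [C mC ->].
  pose J := [fset j in iota 0 i | j \in I]%fset.
  have JE j : (j \in J) = (j < i)%N && (j \in I).
    by rewrite !inE /= mem_iota.
  pose N := \bigcap_(j in [set` J]) (p j @^-1` C j).
  pose M := \bigcap_(j in `I_i `\` I) (p j @^-1` C j).
  have -> : \bigcap_(j in `I_i) (p j @^-1` C j) = N `&` M.
    apply/seteqP; split => w /=.
      move=> Cw; split => j /=.
        by rewrite JE => /andP[ji _]; exact: Cw.
      by move=> [ji _]; exact: Cw.
    move=> [Nw Mw] j /= ji; have [Ij|nIj] := pselect (I j).
      by apply: Nw; rewrite /= JE ji mem_set.
    exact: Mw.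
  have JI : [set` J] `<=` I by move=> j /=; rewrite JE => /andP[_ /set_mem].
  have sN : <<s family_events p I >> N.
    rewrite /N bigcap_fset.
    (* Membership in [<<s _ >>] is measurability in the generated type, where the closure lemmas
       apply. *)
    have : (@measurable _ (g_sigma_algebraType (family_events p I)))
       (\big[setI/setT]_(j <- J) (p j @^-1` C j)); last by [].
    rewrite big_seq; apply: bigsetI_measurable => j jJ.
    by apply: mfamily => //; exact: JI.
  have sM : <<s family_events p (~` I) >> M.
    have : (@measurable _ (g_sigma_algebraType (family_events p (~` I)))) M;
      last by [].
    apply: bigcap_measurableType => j [_ nIj]; exact: mfamily.
  (* Since [i] is not in [J], the constraint [B] can be added at index [i], so that [N] and the
     event on [p i] become one finite intersection over null indices. *)
  pose C' j := if j == i then B else C j.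
  have iJ : i \notin J by rewrite JE ltnn.
  have NB : N `&` p i @^-1` B = \bigcap_(j in [set` (i |` J)%fset]) (p j @^-1` C' j).
    apply/seteqP; split => w /=.
      move=> [Nw Bw] j; rewrite /= in_fset1U /C'; case: eqP => [->//|_ /= jJ].
      exact: Nw.
    move=> Cw; split.
      move=> j /= jJ; have := Cw j; rewrite /= in_fset1U jJ orbT /C'.
      case: eqP => [ji|_]; last exact.
      by move: iJ; rewrite -ji jJ.
    by have := Cw i; rewrite /= fset1U1 /C' eqxx; exact.
  (* The non-null part [M] is split off on both sides: here from [N] joined with the event on [p i],
     then from [N] alone. *)
  rewrite setIAC indN//; last first.
    have : (@measurable _ (g_sigma_algebraType (family_events p I)))
      (N `&` p i @^-1` B); last by [].
    by apply: measurableI => //; exact: mfamily.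
  rewrite (indN N M) // muleAC NB indI.
  - congr (_ * _)%E; rewrite big_fsetU1//= /C' eqxx [RHS]muleC.
    congr (_ * _)%E; rewrite indI //; rewrite [LHS]big_seq [RHS]big_seq.
    by apply: eq_bigr => j jJ; case: eqP => // ji; move: iJ; rewrite -ji jJ.
  - by move=> j /=; rewrite in_fset1U => /orP[/eqP ->//|/JI].
  - by move=> j _; rewrite /C'; case: ifP.
have Pfin C : measurable C -> Pr C \is a fin_num by move=> mC; exact: fin_num_measure.
(* Both sides are finite measures in [A]: [Pr] restricted to the event on [p i], and [Pr] scaled by
   the probability of that event. *)
pose c : {nonneg R} := NngNum (fine_ge0 (measure_ge0 Pr (p i @^-1` B))).
have cE C : mscale c Pr C = (Pr C * Pr (p i @^-1` B))%E.
  by rewrite /mscale /= muleC fineK // Pfin //; exact: mp.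
rewrite -cE; change (mrestr Pr (mp i B mB) A = mscale c Pr A).
apply: (@g_sigma_algebra_measure_unique _ _ _ G _ (fun=> setT)) => //.
- move=> _ [C mC ->]; apply: bigcap_measurableType => j _; exact: mp.
- move=> _; exists (fun=> setT) => //.
  by apply/seteqP; split => w.
- by rewrite bigcup_const //; exists 0%N.
- by move=> D GD; apply: etrans (Gind _ GD) _; exact/esym/cE.
- by move=> _; rewrite /= /mrestr setTI ltey_eq Pfin //; exact: mp.
- by move: sA; apply: sub_smallest2r.
Qed.

(** * Consequences of uniform validity *)

Lemma uniformly_valid_le d (T : measurableType d) (R : realType)
    (Pr : probability T R) (p : {mfun T >-> R}) (x y : R) :
  uniformly_valid Pr p -> 0 <= x <= 1 -> 0 <= y <= 1 ->
  (Pr [set w | (p w <= x * y)%R] <= x%:E * Pr [set w | (p w <= y)%R])%E.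
Proof.
move=> valid x01 y01.
have mle c : measurable [set w | (p w <= c)%R].
  rewrite -[X in measurable X]setTI.
  exact: (@measurable_fun_le _ _ _ setT p (cst c)).
have xy : x * y <= y by move: x01 y01 => /andP[? ?] /andP[? ?]; nra.
have sub : [set w | (p w <= x * y)%R] `<=` [set w | (p w <= y)%R].
  by move=> w /= /le_trans; apply.
have Pxy : (Pr [set w | (p w <= x * y)%R] <= Pr [set w | (p w <= y)%R])%E.
  by apply: le_measure => //; rewrite inE.
(* If the conditioning event has probability zero, uniform validity says nothing, but the smaller
   event then has probability zero too. *)
have [y0|y0] := eqVneq (Pr [set w | (p w <= y)%R]) 0%E.
  by rewrite y0 mule0 -y0.
have {}y0 : (0 < Pr [set w | (p w <= y)%R])%E by rewrite lt0e y0 measure_ge0.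
have := valid _ _ x01 y01 y0.
have fy := fin_num_measure Pr _ (mle y).
have fxy := fin_num_measure Pr _ (mle (x * y)).
rewrite /cond_prob setIidl // ler_pdivrMr; last first.
  by rewrite fine_gt0 // y0 ltey_eq fy.
by rewrite -lee_fin EFinM !fineK.
Qed.

(** Let F be the distribution function of [p]. Uniform validity at [y = t] gives F(x) <= (x/t) F(t)
    for x <= t. At [a] this bounds F(a) from above; at [l] it bounds F(t) - F(l) from below by
    ((t-l)/t) F(t). Comparing the two bounds gives the claim. *)
Lemma uniformly_valid_le_itv d (T : measurableType d) (R : realType)
    (Pr : probability T R) (p : {mfun T >-> R}) (a l t : R) :
  uniformly_valid Pr p -> 0 <= a <= l -> l < t <= 1 ->
  (Pr [set w | (p w <= a)%R] <=
   (a / (t - l))%:E * Pr [set w | (l < p w <= t)%R])%E.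
Proof.
move=> valid /andP[a0 al] /andP[lt t1].
have mle c : measurable [set w | (p w <= c)%R].
  rewrite -[X in measurable X]setTI.
  exact: (@measurable_fun_le _ _ _ setT p (cst c)).
have t0 : 0 < t by lra.
have tl : 0 < t - l by lra.
have key x : 0 <= x <= t ->
    fine (Pr [set w | (p w <= x)%R]) * t <= x * fine (Pr [set w | (p w <= t)%R]).
  move=> /andP[x0 xt].
  have xt01 : 0 <= x / t <= 1.
    by rewrite divr_ge0 ?ler_pdivrMr ?mul1r ?(ltW t0).
  have := @uniformly_valid_le _ _ _ Pr p (x / t) t valid xt01.
  rewrite (ltW t0) t1 => /(_ isT).
  rewrite divfK ?gt_eqF// -[X in (X <= _)%E]fineK ?fin_num_measure//.
  rewrite -[X in (_ <= _ * X)%E]fineK ?fin_num_measure//.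
  rewrite -EFinM lee_fin => h.
  have : fine (Pr [set w | (p w <= x)%R]) * t <=
     x / t * fine (Pr [set w | (p w <= t)%R]) * t by rewrite ler_pM2r.
  by rewrite mulrAC divfK ?gt_eqF.
have itvE : [set w | (l < p w <= t)%R] = [set w | (p w <= t)%R] `\` [set w | (p w <= l)%R].
  apply/seteqP; split => w /=; first by move=> /andP[]; rewrite ltNge => /negP.
  by move=> [-> /negP]; rewrite -ltNge => ->.
have PE : (Pr [set w | (l < p w <= t)%R] =
    (fine (Pr [set w | (p w <= t)%R]) - fine (Pr [set w | (p w <= l)%R]))%:E)%E.
  rewrite itvE measureD//; last by rewrite ltey_eq fin_num_measure.
  rewrite setIidr ?EFinB ?fineK ?fin_num_measure//.
  by move=> w /= /le_trans; apply; exact: ltW.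
rewrite PE -[X in (X <= _)%E]fineK ?fin_num_measure// -EFinM lee_fin.
rewrite mulrAC ler_pdivlMr//.
have := key a; have := key l.
set Fa := fine _; set Fl := fine _; set Ft := fine (Pr [set w | (p w <= t)%R]).
have -> : 0 <= l <= t by lra.
have -> : 0 <= a <= t by lra.
move=> /(_ isT) hl /(_ isT) ha.
(* The bounds at [l] and at [a], weighted by [a] and [t - l], add up to the goal multiplied by
   [t]. *)
rewrite -(ler_pM2r t0).
have := ler_wpM2l a0 hl; have := ler_wpM2l (ltW tl) ha.
nra.
Qed.

(** * Measurability and generated sigma-algebras *)

Lemma measurable_funV_gt0 d (T : measurableType d) (R : realType) (f : T -> R) :
  measurable_fun setT f -> (forall w, 0 < f w) ->
  measurable_fun setT (fun w => (f w)^-1).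
Proof.
move=> mf f0; under eq_fun do rewrite -powR_inv1 ?ltW//.
exact: (measurableT_comp (measurable_powR (-1)) mf).
Qed.

Lemma sigma_family_events_sub d (T : measurableType d) (R : realType)
    (X : nat -> T -> R) (I J : set nat) :
  I `<=` J -> <<s family_events X I >> `<=` <<s family_events X J >>.
Proof.
move=> IJ; have sIJ : family_events X I `<=` family_events X J.
  exact: bigcup_subset.
exact: (sub_sigma_algebra2 sIJ).
Qed.

Lemma family_measurable_sub d (T : measurableType d) (R : realType)
    (X : nat -> T -> R) (I J : set nat) (Y : T -> R) :
  I `<=` J -> family_measurable X I Y -> family_measurable X J Y.
Proof.
by move=> IJ mY _ B mB; exact: sigma_family_events_sub (mY measurableT B mB).
Qed.

Lemma family_measurable_mem d (T : measurableType d) (R : realType)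
    (X : nat -> T -> R) (I : set nat) (i : nat) :
  I i -> family_measurable X I (X i).
Proof.
have sX := @sub_sigma_algebra T setT (family_events X I).
by move=> Ii _ B mB; apply: (sX); exists i => //; exists B.
Qed.

(** * The level process and the false rejections *)

(** A boolean recursion instead of an existential, so that measurability with respect to the past
    follows by induction; stage [i] sees only indices below [i]. *)
Fixpoint false_rejection (T : Type) (R : realType) (p a : nat -> T -> R)
    (I : set nat) (i : nat) (w : T) : bool :=
  if i is j.+1 then
    false_rejection p a I j w || ((j \in I) && (p j w <= a j w))
  else false.

Lemma false_rejectionP (T : Type) (R : realType) (p a : nat -> T -> R)
    (I : set nat) (i : nat) (w : T) :
  false_rejection p a I i w <->
  exists2 j, I j & (j < i)%N /\ p j w <= a j w.
Proof.
elim: i => [|i IH] /=; first by split => // -[j _ []].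
split=> [/orP[/IH[j Ij [ji pa]]|/andP[/set_mem Ii pa]]|[j Ij [ji pa]]].
- by exists j => //; split => //; exact: ltnW.
- by exists i.
- move: ji; rewrite ltnS leq_eqVlt => /orP[/eqP <-|ji].
    by rewrite mem_set//= pa orbT.
  by apply/orP; left; apply/IH; exists j.
Qed.

Section addis_process.
Context d (T : measurableType d) (R : realType) (alpha : R).
Variables (p : nat -> {mfun T >-> R}) (tau lambda a : nat -> T -> R).
Hypotheses (alpha01 : 0 < alpha < 1)
  (addis : exhaustive_ADDIS alpha p tau lambda a).

Let level := addis_level alpha tau lambda a p.

(** Each decrement is nonnegative because the level is at most [alpha < 1], so the level never
    rises; the spending constraint keeps it nonnegative. *)
Lemma addis_level_itv i w : 0 <= level i w <= alpha.
Proof.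
elim: i => [|i /andP[l0 la]] /=; first by rewrite /level/= lexx andbT ltW// (andP alpha01).1.
rewrite /level /= -/level; case: ifP => _; last by rewrite l0.
have /= -> /= := addis_level_ge0 addis i w; rewrite (le_trans _ la)// gerBl.
move: alpha01 => /andP[_ a1].
have /andP[_ lt] := addis_lambda_bounds addis i w.
have /andP[a0 _] := addis_a_bounds addis i w.
by rewrite !divr_ge0 ?mulr_ge0 ?subr_ge0// ?(ltW lt)// (le_trans la)// ltW.
Qed.

(* A level below [1] cannot pay for a test level above [lambda], since
   [lambda >= level * tau]. *)
Lemma addis_a_le_lambda i w : a i w <= lambda i w.
Proof.
have /andP[l0 la] := addis_level_itv i w.
move: alpha01 => /andP[_ a1].
have /andP[ltl lt] := addis_lambda_bounds addis i w.
have := addis_level_ge0 addis i w.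
rewrite -/(level _ _) /= in ltl *.
rewrite -/(level i w) subr_ge0 ler_pdivrMr ?subr_gt0// => h.
have l1 : 0 < 1 - level i w by lra.
(* With l the level, a (1 - l) <= l (tau - lambda) <= l tau (1 - l), the second inequality by lambda
   >= l tau; then 1 - l > 0 cancels. *)
rewrite (le_trans _ ltl)// -(ler_pM2r l1).
nra.
Qed.

Lemma addis_level_measurable i : family_measurable p `I_i (level i).
Proof.
elim: i => [|i IH]; first by rewrite /family_measurable; exact: measurable_cst.
have sub : `I_i `<=` `I_i.+1 by move=> j /=; exact: ltnW.
have mt := family_measurable_sub sub (@addis_tau_predictable _ _ _ _ _ _ _ _ addis i).
have ml := family_measurable_sub sub (@addis_lambda_predictable _ _ _ _ _ _ _ _ addis i).
have ma := family_measurable_sub sub (@addis_a_predictable _ _ _ _ _ _ _ _ addis i).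
have mp : family_measurable p `I_i.+1 (p i) by apply: family_measurable_mem => /=.
have mA := family_measurable_sub sub IH.
rewrite /family_measurable /level /=; apply: measurable_fun_ifT => //.
  by apply: measurable_and; [exact: measurable_fun_ltr|exact: measurable_fun_ler].
apply: measurable_funB => //; apply: measurable_funM.
  by apply: measurable_funM => //; exact: measurable_funB.
apply: measurable_funV_gt0; first exact: measurable_funB.
by move=> w; rewrite subr_gt0; have /andP[] := addis_lambda_bounds addis i w.
Qed.

Lemma false_rejection_measurable (I : set nat) i :
  measurable_fun [set: g_sigma_algebraType (family_events p `I_i)]
    (false_rejection p a I i : g_sigma_algebraType (family_events p `I_i) -> bool).
Proof.
elim: i => [|i IH] //=.
have sub : `I_i `<=` `I_i.+1 by move=> j /=; exact: ltnW.
have ma := family_measurable_sub sub (@addis_a_predictable _ _ _ _ _ _ _ _ addis i).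
have mp : family_measurable p `I_i.+1 (p i) by apply: family_measurable_mem => /=.
apply: measurable_or.
  by move=> _ B mB; exact: sigma_family_events_sub (IH measurableT B mB).
by apply: measurable_and => //; exact: measurable_fun_ler.
Qed.

End addis_process.

(** * The past as a random variable *)

(** Turns the whole past into one random variable, so that [integral_indep_pair] applies with [Y]
    the identity of [T]. *)
Lemma measurable_past d (T : measurableType d) (R : realType)
    (p : nat -> {mfun T >-> R}) (I : set nat) :
  measurable_fun setT (id : T -> g_sigma_algebraType (family_events p I)).
Proof.
move=> _ A; rewrite setTI preimage_id.
apply: (@smallest_sub _ _ _ measurable) => [|B [i _ [C mC <-]]].
  exact: sigma_algebra_measurable.
by rewrite setTI -[X in measurable X]setTI; exact: measurable_funP.
Qed.

Lemma measurable_fun_past d d' (T : measurableType d) (U : measurableType d')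
    (R : realType) (p : nat -> {mfun T >-> R}) (I : set nat) (f : T -> U) :
  measurable_fun [set: g_sigma_algebraType (family_events p I)]
    (f : g_sigma_algebraType (family_events p I) -> U) ->
  measurable_fun [set: T] f.
Proof. by move=> mf; exact: (measurableT_comp mf (@measurable_past d T R p I)).
Qed.

(** Evaluates the inner integrals of the gain and of the loss once the past is frozen. *)
Lemma integral_distribution_bool d (T : measurableType d) (R : realType)
    (Pr : probability T R) (X : {mfun T >-> R}) (c : R) (b : R -> bool) :
  0 <= c -> measurable_fun setT b ->
  (\int[distribution Pr X]_x (c * (b x)%:R)%:E = c%:E * Pr [set w | b (X w)])%E.
Proof.
move=> c0 mb; have mB : measurable [set x | b x].
  by rewrite -[X in measurable X]setTI; exact: (mb _ [set true]).
under eq_integral do rewrite EFinM.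
rewrite ge0_integralZl_EFin //; last first.
  have -> : (fun x => (b x)%:R%:E) = EFin \o \1_[set x | b x] :> (R -> \bar R).
    by apply/funext => x; rewrite /= indicE mem_setE.
  exact/measurable_EFinP/measurable_indicP.
congr (_ * _)%E.
transitivity (\int[distribution Pr X]_x (\1_[set x | b x] x)%:E)%E.
  by apply: eq_integral => x _; rewrite indicE mem_setE.
by rewrite integral_indic // setIT.
Qed.

(** * The potential [Z] and its nonincreasing expectation *)

Section addis_potential.
Context d (T : measurableType d) (R : realType) (alpha : R).
Variables (p : nat -> {mfun T >-> R}) (tau lambda a : nat -> T -> R).
Variables (Pr : probability T R) (I : set nat).
Hypotheses (alpha01 : 0 < alpha < 1)
  (addis : exhaustive_ADDIS alpha p tau lambda a)
  (valid : forall i, I i -> uniformly_valid Pr (p i))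
  (indep_null : mutually_independent Pr p I)
  (indep_nonnull : independent_families Pr p I (~` I)).

Let level := addis_level alpha tau lambda a p.
Let S := false_rejection p a I.
Let Z i w : R := if S i w then 1 else level i w.

Let level_itv i w : 0 <= level i w <= 1.
Proof.
have /andP[l0 la] := addis_level_itv alpha01 addis i w.
by move: alpha01 => /andP[_ a1]; rewrite l0 (le_trans la)// ltW.
Qed.

Let Z_itv i w : 0 <= Z i w <= 1.
Proof. by rewrite /Z; case: ifP => _; rewrite ?ler01 ?lexx. Qed.

Let mS i : measurable_fun setT (S i).
Proof.
exact: measurable_fun_past (@false_rejection_measurable _ _ _ _ _ _ _ _ addis I i).
Qed.

Let mZ i : measurable_fun setT (Z i).
Proof.
apply: measurable_fun_ifT => //.
exact: measurable_fun_past (@addis_level_measurable _ _ _ _ _ _ _ _ addis i).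
Qed.

Let slope i w := a i w / (tau i w - lambda i w).

Let slope_ge0 i w : 0 <= slope i w.
Proof.
have /andP[_ lt] := addis_lambda_bounds addis i w.
have /andP[a0 _] := addis_a_bounds addis i w.
by rewrite divr_ge0 // subr_ge0 ltW.
Qed.

(** The height of the jump of [Z] to [1] at a first false rejection; it vanishes afterwards, when
    [Z] stays at [1]. *)
Let weight i w : R := if S i w then 0 else 1 - level i w.

Let weight_ge0 i w : 0 <= weight i w.
Proof.
rewrite /weight; case: ifP => // _; rewrite subr_ge0.
by have /andP[] := level_itv i w.
Qed.

(** For a null index, [gain] is the rise of [Z] through a false rejection and [loss] its fall
    through spending. The p-value is a separate argument [x]: all other factors depend only on the
    past, which can be frozen while [x] is integrated under the law of [p i]. *)
Let gain i w (x : R) : R := weight i w * (x <= a i w)%R%:R.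
Let loss i w (x : R) : R := weight i w * slope i w * (lambda i w < x <= tau i w)%R%:R.

Let SS i w : S i.+1 w = S i w || ((i \in I) && (p i w <= a i w)).
Proof. by []. Qed.

Let levelS i w :
  level i.+1 w = level i w -
    (1 - level i w) * slope i w * (lambda i w < p i w <= tau i w)%R%:R.
Proof.
rewrite {1}/level /= -/(level i w) /slope; case: ifP => _.
  by rewrite mulr1; congr (_ - _); ring.
by rewrite mulr0 subr0.
Qed.

Let levelS_le i w : level i.+1 w <= level i w.
Proof.
rewrite levelS gerBl; apply: mulr_ge0 => //; apply: mulr_ge0 => //.
by rewrite subr_ge0; have /andP[] := level_itv i w.
Qed.

(* Rejecting a null requires [p i w <= a i w <= lambda i w], where the level
   does not change, so that gain and loss never occur together. *)
Let Z_null i w : I i -> Z i.+1 w + loss i w (p i w) = Z i w + gain i w (p i w).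
Proof.
move=> Ii; rewrite /Z /loss /gain /weight SS mem_set //=.
case: (S i w) => /=; first by rewrite !mul0r.
have al := addis_a_le_lambda alpha01 addis i w.
case: (leP (p i w) (a i w)) => [pa|ap] /=.
  by rewrite ltNge (le_trans pa al) /= mulr0 mulr1; ring.
by rewrite levelS mulr0 addr0 subrK.
Qed.

Let Z_nonnull i w : ~ I i -> Z i.+1 w <= Z i w.
Proof.
move=> nIi; rewrite /Z SS memNset //= orbF.
by case: ifP => // _; exact: levelS_le.
Qed.

Let past i := g_sigma_algebraType (family_events p `I_i).

Let measurable_indicator d' (U : measurableType d') (b : U -> bool) :
  measurable_fun setT b -> measurable_fun setT (fun z => (b z)%:R : R).
Proof.
move=> mb; rewrite (_ : (fun z => _) = (fun z => if b z then 1 else 0)).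
  exact: measurable_fun_ifT.
by apply/funext => z; case: (b z).
Qed.

Let measurable_fst_past i (h : past i -> R) : measurable_fun setT h ->
  measurable_fun setT (fun z : past i * R => h z.1).
Proof. by move=> mh; exact: (measurableT_comp mh measurable_fst). Qed.

Let mweight i : measurable_fun [set: past i] (weight i).
Proof.
apply: measurable_fun_ifT => //.
  exact: (@false_rejection_measurable _ _ _ _ _ _ _ _ addis I i).
apply: measurable_funB => //.
exact: (@addis_level_measurable _ _ _ _ _ _ _ _ addis i).
Qed.

Let mgain i : measurable_fun [set: past i * R] (fun z => gain i z.1 z.2).
Proof.
have ma : measurable_fun [set: past i] (a i).
  exact: (@addis_a_predictable _ _ _ _ _ _ _ _ addis i).
apply: measurable_funM; first exact: measurable_fst_past.
apply: measurable_indicator; apply: measurable_fun_ler.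
  exact: measurable_snd.
exact: measurable_fst_past.
Qed.

Let mloss i : measurable_fun [set: past i * R] (fun z => loss i z.1 z.2).
Proof.
have mt : measurable_fun [set: past i] (tau i).
  exact: (@addis_tau_predictable _ _ _ _ _ _ _ _ addis i).
have ml : measurable_fun [set: past i] (lambda i).
  exact: (@addis_lambda_predictable _ _ _ _ _ _ _ _ addis i).
have ma : measurable_fun [set: past i] (a i).
  exact: (@addis_a_predictable _ _ _ _ _ _ _ _ addis i).
have ms : measurable_fun [set: past i] (slope i).
  apply: measurable_funM => //; apply: measurable_funV_gt0.
    exact: measurable_funB.
  by move=> w; rewrite subr_gt0; have /andP[] := addis_lambda_bounds addis i w.
apply: measurable_funM.
  by apply: measurable_funM; exact: measurable_fst_past.
apply: measurable_indicator; apply: measurable_and.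
  apply: measurable_fun_ltr; last exact: measurable_snd.
  exact: measurable_fst_past.
apply: measurable_fun_ler; first exact: measurable_snd.
exact: measurable_fst_past.
Qed.

Let gain_ge0 i w x : 0 <= gain i w x.
Proof. exact: mulr_ge0. Qed.

Let loss_ge0 i w x : 0 <= loss i w x.
Proof. by do 2 apply: mulr_ge0 => //. Qed.

Let pasti i : {mfun T >-> past i} :=
  mfun_Sub (mem_set (@measurable_past _ _ _ p `I_i)).

(** By independence from the past, both expectations become iterated integrals, and the inner ones
    are compared for each fixed past by [uniformly_valid_le_itv]. *)
Let integral_gain_le i : I i ->
  (\int[Pr]_w (gain i w (p i w))%:E <= \int[Pr]_w (loss i w (p i w))%:E)%E.
Proof.
move=> Ii.
have mEgain : measurable_fun setT (fun z : past i * R => (gain i z.1 z.2)%:E).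
  exact/measurable_EFinP.
have mEloss : measurable_fun setT (fun z : past i * R => (loss i z.1 z.2)%:E).
  exact/measurable_EFinP.
have gain0 (z : past i * R) : (0 <= (gain i z.1 z.2)%:E)%E by rewrite lee_fin.
have loss0 (z : past i * R) : (0 <= (loss i z.1 z.2)%:E)%E by rewrite lee_fin.
have ind (A : set (past i)) (B : set R) : measurable A -> measurable B ->
    Pr (pasti i @^-1` A `&` p i @^-1` B) = (Pr (pasti i @^-1` A) * Pr (p i @^-1` B))%E.
  by move=> mA mB; exact: null_indep_past indep_null indep_nonnull Ii mA mB.
have := integral_indep_pair ind mEgain gain0.
rewrite /= => ->.
have := integral_indep_pair ind mEloss loss0.
rewrite /= => ->.
have mF (h : past i * R -> \bar R) : measurable_fun setT h ->
    (forall z, 0 <= h z)%E ->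
    measurable_fun setT (fun w : T => \int[distribution Pr (p i)]_x h (w, x))%E.
  move=> mh h0.
  apply: (@measurable_fun_past _ _ _ _ _ p `I_i).
  have : measurable_fun [set: past i] (fubini_F (distribution Pr (p i)) h) by
    exact: measurable_fun_fubini_tonelli_F.
  exact.
apply: ge0_le_integral => //.
- by move=> w _; apply: integral_ge0 => x _; exact: (gain0 (w, x)).
- exact: (mF _ mEgain gain0).
- exact: (mF _ mEloss loss0).
(* With the past [w] fixed, the weight and the parameters are constants, so each inner integral is a
   constant times the probability that [p i] falls in a fixed interval. *)
move=> w _; rewrite integral_distribution_bool //; last first.
  exact: measurable_fun_ler.
rewrite integral_distribution_bool; last 2 first.
- exact: mulr_ge0.
- by apply: measurable_and; [exact: measurable_fun_ltr|exact: measurable_fun_ler].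
rewrite EFinM -muleA lee_wpmul2l ?lee_fin //.
apply: uniformly_valid_le_itv; first exact: valid.
  have /andP[-> _] := addis_a_bounds addis i w.
  exact: addis_a_le_lambda alpha01 addis i w.
have /andP[_ ->] := addis_lambda_bounds addis i w.
by have /andP[_ ->] := addis_tau_bounds addis i w.
Qed.

(** A non-null index lowers [Z] pointwise. For a null index, [Z_null] is integrated and the expected
    loss, which dominates the expected gain, is cancelled. *)
Let integral_ZS_le i :
  (\int[Pr]_w (Z i.+1 w)%:E <= \int[Pr]_w (Z i w)%:E)%E.
Proof.
have Z0 j w : (0 <= (Z j w)%:E)%E by have /andP[] := Z_itv j w.
have mEZ j : measurable_fun setT (EFin \o Z j) by exact/measurable_EFinP.
have [Ii|nIi] := pselect (I i); last first.
  apply: ge0_le_integral; [by []|by []|exact: mEZ|exact: mEZ|].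
  by move=> w _; rewrite lee_fin; exact: Z_nonnull.
have mpair : measurable_fun setT (fun w => (pasti i w, p i w)).
  exact: measurable_fun_pair.
have mgT : measurable_fun setT (fun w => (gain i w (p i w))%:E).
  by apply/measurable_EFinP; exact: (measurableT_comp (@mgain i) mpair).
have mlT : measurable_fun setT (fun w => (loss i w (p i w))%:E).
  by apply/measurable_EFinP; exact: (measurableT_comp (@mloss i) mpair).
(* Cancellation in the extended reals needs a finite expected loss. Where [p i] exceeds [a i] the
   gain is zero, so the loss is a difference of two values of [Z] in [0,1]; elsewhere
   [p i <= a i <= lambda i] and the loss is zero. *)
have loss1 : (\int[Pr]_w (loss i w (p i w))%:E <= 1)%E.
  rewrite -(probability_setT Pr) -[leRHS]mul1e -(integral_cst Pr measurableT 1).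
  apply: ge0_le_integral => //; first by move=> w _; rewrite lee_fin.
  move=> w _; rewrite lee_fin.
  have /andP[_ Z1] := Z_itv i w; have /andP[Z'0 _] := Z_itv i.+1 w.
  have := Z_null w Ii; rewrite /gain.
  case: (leP (p i w) (a i w)) => [pa _|_]; last by rewrite mulr0; lra.
  rewrite /loss ltNge (le_trans pa) ?mulr0 //.
  exact: addis_a_le_lambda alpha01 addis i w.
have loss_fin : (\int[Pr]_w (loss i w (p i w))%:E)%E \is a fin_num.
  rewrite ge0_fin_numE; first exact: le_lt_trans loss1 (ltry _).
  by apply: integral_ge0 => w _; rewrite lee_fin.
have sumE j (h : T -> R) : (forall w, 0 <= h w) ->
    measurable_fun setT (EFin \o h) ->
    (\int[Pr]_w (Z j w)%:E + \int[Pr]_w (h w)%:E =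
     \int[Pr]_w (Z j w + h w)%:E)%E.
  move=> h0 mh; rewrite -(ge0_integralD Pr measurableT _ (mEZ j) _ mh) //.
    by move=> w _; exact: Z0.
  by move=> w _; rewrite /= lee_fin.
(* Adding the loss to both sides, instead of subtracting it, keeps every integrand nonnegative. *)
rewrite -(leeD2rE _ _ loss_fin) sumE //.
under eq_integral do rewrite Z_null //.
by rewrite -sumE // leeD2l // integral_gain_le.
Qed.

(** [Z n] dominates the indicator of a false rejection, since it equals [1] there and is nonnegative
    elsewhere, and its expectation is at most that of the constant [Z 0 = alpha]. *)
Lemma false_rejection_le n : (Pr [set w | S n w] <= alpha%:E)%E.
Proof.
have mSn : measurable [set w | S n w].
  by rewrite -[X in measurable X]setTI; exact: (@mS n measurableT [set true]).
have : (\int[Pr]_w (Z n w)%:E <= alpha%:E)%E.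
  elim: n {mSn} => [|n IH]; last exact: le_trans (integral_ZS_le n) IH.
  rewrite /Z /= /level /=.
  rewrite (integral_cst Pr measurableT alpha%:E).
  by rewrite [X in (_ * X)%E](probability_setT Pr) mule1.
apply: le_trans; rewrite -(setIT [set w | S n w]) -integral_indic//.
apply: ge0_le_integral.
- exact: measurableT.
- by move=> w _; rewrite lee_fin.
- exact/measurable_EFinP/measurable_indicP.
- exact/measurable_EFinP.
move=> w _; rewrite lee_fin indicE mem_setE -[w \in _]/(S n w) /Z; case: (S n w) => //=.
by have /andP[] := level_itv n w.
Qed.

End addis_potential.

(** * Passage to infinitely many hypotheses *)

Theorem theorem3p2 (d : measure_display) (T : measurableType d) (R : realType)
    (model : set (probability T R)) (H : nat -> set (probability T R))
    (p : nat -> {mfun T >-> R}) (alpha : R) (tau lambda a : nat -> T -> R)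
    (p01 : forall i w, 0 <= p i w <= 1)
    (alpha01 : 0 < alpha < 1)
    (addis : exhaustive_ADDIS alpha p tau lambda a)
    (Pr : probability T R) (Pr_model : model Pr)
    (valid : forall i, true_nulls H Pr i -> uniformly_valid Pr (p i))
    (indep_null : mutually_independent Pr p (true_nulls H Pr))
    (indep_nonnull :
      independent_families Pr p (true_nulls H Pr) (~` true_nulls H Pr)) :
  (FWER Pr (true_nulls H Pr) p a <= alpha%:E)%E.
Proof.
set I := true_nulls H Pr.
pose S n := [set w | false_rejection p a I n w].
have mS n : measurable (S n).
  rewrite -[X in measurable X]setTI.
  have mF := measurable_fun_past (@false_rejection_measurable _ _ _ _ _ _ _ _ addis I n).
  exact: (mF measurableT [set true]).
have -> : FWER Pr I p a = Pr (\bigcup_n S n).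
  congr (Pr _); apply/seteqP; split => [w [i Ii pa]|w [n _ /false_rejectionP]].
    by exists i.+1 => //; apply/false_rejectionP; exists i.
  by move=> [i Ii [_ pa]]; exists i.
have ndS : {homo S : n m / (n <= m)%N >-> (n <= m)%O}.
  move=> n m nm; apply/subsetPset => w /false_rejectionP[i Ii [ilt pa]].
  by apply/false_rejectionP; exists i => //; split => //; exact: leq_trans nm.
(* Continuity from below: the events [S n] increase to the event of some false rejection, so a bound
   uniform in [n] passes to the limit. *)
have cvgS : Pr \o S @ \oo --> Pr (\bigcup_n S n).
  by apply: nondecreasing_cvg_mu => //; exact: bigcup_measurable.
rewrite -(cvg_lim _ cvgS)//; apply: lime_le; first exact: (cvgP _ cvgS).
apply: nearW => n.
exact: (false_rejection_le alpha01 addis valid indep_null indep_nonnull).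
Qed.
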